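(* A finite interval order $P=(X,\prec)$ is a unit OC interval order if and only if it contains no induced subposet isomorphic to any of the posets $\mathbf{4}+\mathbf{1}$, $D^*$, $Z$, $Y^*$, $Y^{**}$, or the duals of these five posets.
   Context: Posets are strict (irreflexive) partial orders; twins are allowed. $P$ is an interval order if each $x$ can be assigned a closed real interval $[L(x),R(x)]$ with $x\prec y$ iff $R(x)<L(y)$. An OC interval representation assigns to each $x$ a real interval $I(x)$ that is either open or closed such that $x\prec y$ iff every point of $I(x)$ is less than every point of $I(y)$; $P$ is a unit OC interval order if it has such a representation with all intervals of equal length. In the following posets, comparabilities are the listed ones together with their transitive consequences, and all other pairs are incomparable. $\mathbf{4}+\mathbf{1}$: elements $a,b,c,d,x$ with $a\prec b\prec c\prec d$. $D^*$: elements $a,b,c,d,x,y$ with $a\prec b\prec d$, $a\prec c\prec d$, $y\prec c$. $Z$: elements $a,b,c,d,x,y$ with $a\prec b\prec c\prec d$, $x\prec d$, $a\prec y$. $Y^*$: elements $a,d,p,c,q,b$ with $a\prec d\prec p\prec c$, $q\prec c$, $d\prec b$. $Y^{**}$: elements $a,b,c,d,x,y$ with $a\prec d\prec b$, $a\prec d\prec c$, $y\prec c$. The dual of a poset reverses all comparabilities. *)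

(* Defs.v *)
From mathcomp Require Import all_boot.
From Stdlib Require Import Reals.

Set Implicit Arguments.
Unset Strict Implicit.
Unset Printing Implicit Defensive.

Definition strict_poset (T : finType) (r : rel T) : Prop :=
  (forall x, ~~ r x x) /\ (forall x y z, r x y -> r y z -> r x z).

Definition interval_order (T : finType) (r : rel T) : Prop :=
  exists (L Rt : T -> R),
    (forall x, Rle (L x) (Rt x)) /\
    (forall x y, r x y <-> Rlt (Rt x) (L y)).

Definition oc_mem (l rt : R) (op : bool) (p : R) : Prop :=
  if op then Rlt l p /\ Rlt p rt else Rle l p /\ Rle p rt.

Definition oc_nonempty (l rt : R) (op : bool) : Prop :=
  if op then Rlt l rt else Rle l rt.

Definition unit_OC_interval_order (T : finType) (r : rel T) : Prop :=
  exists (l rt : T -> R) (op : T -> bool),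
    (forall x, oc_nonempty (l x) (rt x) (op x)) /\
    (forall x y, Rminus (rt x) (l x) = Rminus (rt y) (l y)) /\
    (forall x y, r x y <->
       (forall p q, oc_mem (l x) (rt x) (op x) p ->
                    oc_mem (l y) (rt y) (op y) q -> Rlt p q)).

Definition gen_rel (n : nat) (E : seq (nat * nat)) : rel 'I_n :=
  fun i j => (nat_of_ord i, nat_of_ord j) \in E.

Definition tc_rel (n : nat) (E : seq (nat * nat)) : rel 'I_n :=
  fun i j => [exists k, gen_rel E i k && connect (gen_rel E) k j].

Definition dual_rel (T : Type) (r : rel T) : rel T := fun x y => r y x.

(* 4+1 : a=0 b=1 c=2 d=3 x=4 ; a<b<c<d *)
Definition four_plus_one : rel 'I_5 := tc_rel [:: (0,1); (1,2); (2,3)].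
(* D* : a=0 b=1 c=2 d=3 x=4 y=5 ; a<b<d, a<c<d, y<c *)
Definition D_star : rel 'I_6 := tc_rel [:: (0,1); (1,3); (0,2); (2,3); (5,2)].
(* Z : a=0 b=1 c=2 d=3 x=4 y=5 ; a<b<c<d, x<d, a<y *)
Definition Z_poset : rel 'I_6 := tc_rel [:: (0,1); (1,2); (2,3); (4,3); (0,5)].
(* Y* : a=0 d=1 p=2 c=3 q=4 b=5 ; a<d<p<c, q<c, d<b *)
Definition Y_star : rel 'I_6 := tc_rel [:: (0,1); (1,2); (2,3); (4,3); (1,5)].
(* Y** : a=0 b=1 c=2 d=3 x=4 y=5 ; a<d<b, a<d<c, y<c *)
Definition Y_star_star : rel 'I_6 := tc_rel [:: (0,3); (3,1); (3,2); (5,2)].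

Definition contains_induced (n : nat) (q : rel 'I_n) (T : finType) (r : rel T)
  : Prop :=
  exists f : 'I_n -> T, injective f /\ forall i j, r (f i) (f j) = q i j.

(* Main.v *)
Require Import Defs.
From mathcomp Require Import all_boot zify.
From Stdlib Require Import Reals ZArith Lra Lia.

(** In a unit representation an element [b] strictly inside [x] (the middle of a
    3+1) is forced to be open, [x] to be closed, and both to occupy the same
    place.  Conversely, take endpoints whose strict comparisons are all witnessed
    in the order, move every inner element onto an element containing it, and
    declare exactly the inner elements open.  The remaining closed elements are
    linearly preordered by their endpoints; requiring distance exactly one when
    [x] and [y] are incomparable but some elements placed at [x] and [y] are
    comparable, distance more than one when [x] precedes [y], and less than one
    otherwise, gives a system that the forbidden posets make monotone in this
    preorder, so that it can be solved greedily from left to right.  For the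
    other direction, each forbidden poset yields an infeasible linear system. *)

Set Implicit Arguments.
Unset Strict Implicit.
Unset Printing Implicit Defensive.

(** * Computable comparabilities and embeddings of small posets *)

Fixpoint reach (fuel : nat) (E : seq (nat * nat)) (i j : nat) : bool :=
  if fuel is k.+1 then
    has (fun e => (e.1 == i) && ((e.2 == j) || reach k E e.2 j)) E
  else false.

Definition edges_below (n : nat) (E : seq (nat * nat)) : bool :=
  all (fun e => (e.1 < n) && (e.2 < n)) E.

Lemma reach_tc_rel n E : edges_below n E ->
  forall k (i j : 'I_n), reach k E i j -> tc_rel E i j.
Proof.
move=> /allP En; elim=> [//|k IHk] i j /hasP[[u v] uvE /=].
case/andP=> /eqP ui; subst u.
have /andP[/= _ vn] := En _ uvE.
case/orP=> [/eqP vj | vj]; apply/existsP.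
  by exists j; rewrite connect0 andbT /gen_rel -vj.
exists (Ordinal vn); rewrite /gen_rel /= uvE /=.
have /existsP[w /andP[vw wj]] := IHk (Ordinal vn) j vj.
exact: connect_trans (connect1 vw) wj.
Qed.

Lemma path_reach n E (p : seq 'I_n) : forall (i k : 'I_n),
  gen_rel E i k -> path (gen_rel E) k p -> reach (size p).+1 E i (last k p).
Proof.
elim: p => [|w p IHp] i k ik /=.
  by move=> _; apply/hasP; exists (val i, val k) => //=; rewrite !eqxx.
case/andP=> kw wp; apply/hasP; exists (val i, val k) => //=.
by rewrite eqxx /=; apply/orP; right; apply: (IHp k w).
Qed.

Lemma reach_leq E k l i j : k <= l -> reach k E i j -> reach l E i j.
Proof.
elim: k l i => [//|k IHk] [//|l] i kl /= /hasP[e eE /andP[ei ej]].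
apply/hasP; exists e; rewrite // ei /=.
by case/orP: ej => [->//|/(IHk l _ kl) ->]; rewrite orbT.
Qed.

(** A walk can be shortened until the vertices after its start are distinct, so [n] edges of fuel
    suffice. *)
Lemma tc_relE n E (i j : 'I_n) : edges_below n E ->
  tc_rel E i j = reach n E i j.
Proof.
move=> En; apply/idP/idP; last exact: reach_tc_rel.
case/existsP=> k /andP[ik /connectP[p kp ->]].
case/shortenP: kp => q kq uq _.
apply: reach_leq (path_reach ik kq).
by have := max_card (mem (k :: q)); rewrite (card_uniqP uq) card_ord.
Qed.

(** Vertices told apart by their comparabilities cannot be merged by a map that preserves and
    reflects the relation, so injectivity comes by computation. *)
Definition separates (n : nat) (E : seq (nat * nat)) : bool :=
  all (fun i => all (fun j => (i == j) || has (fun k =>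
    (reach n E i k != reach n E j k) || (reach n E k i != reach n E k j))
    (iota 0 n)) (iota 0 n)) (iota 0 n).

Lemma contains_induced_nth (T : finType) (r : rel T) n E (x0 : T) (s : seq T) :
  edges_below n E -> separates n E ->
  (forall i j, i < n -> j < n -> r (nth x0 s i) (nth x0 s j) = reach n E i j) ->
  contains_induced (@tc_rel n E) r.
Proof.
move=> En sepE rE; exists (fun i : 'I_n => nth x0 s i); split; last first.
  by move=> i j; rewrite rE // tc_relE.
move=> i j ij; apply: val_inj; apply/eqP.
have iotaP (k : 'I_n) : val k \in iota 0 n by rewrite mem_iota /=.
have := allP (allP sepE _ (iotaP i)) _ (iotaP j).
case: eqP => //= _ /hasP[k]; rewrite mem_iota /= => kn.
by rewrite -!rE // ij !eqxx.
Qed.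

(** * Canonical integer endpoints of an interval order *)

Definition avoids (T : finType) (r : rel T) : Prop :=
  ~ contains_induced four_plus_one r /\ ~ contains_induced D_star r /\
  ~ contains_induced Z_poset r /\ ~ contains_induced Y_star r /\
  ~ contains_induced Y_star_star r.

(* The gap conditions make every strict comparison of endpoints visible in [r]. *)
Record canonical_rep (T : finType) (r : rel T) (L U : T -> Z) : Prop := {
  ends_le : forall x, (L x <= U x)%Z;
  precE : forall x y, r x y <-> (U x < L y)%Z;
  left_gap : forall x y, (L x < L y)%Z -> exists u, (L x <= U u < L y)%Z;
  right_gap : forall x y, (U x < U y)%Z -> exists u, (U x < L u <= U y)%Z
}.

Arguments ends_le [T r L U] _ _.

Lemma canonical_rep_dual (T : finType) (r : rel T) L U :
  canonical_rep r L U ->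
  canonical_rep (dual_rel r) (fun x => - U x)%Z (fun x => - L x)%Z.
Proof.
case=> lu rE gL gR; split.
- by move=> x; have := lu x; lia.
- by move=> x y; rewrite /dual_rel rE; lia.
- by move=> x y xy; have [|u ?] := gR y x; [lia | exists u; lia].
- by move=> x y xy; have [|u ?] := gL y x; [lia | exists u; lia].
Qed.

(** Predecessor sets are nested, so they can be replaced by their sizes: [L x] counts the
    predecessors of [x], and [U x] is the largest such count among elements not above [x]. *)
Lemma interval_order_canonical (T : finType) (r : rel T) :
  interval_order r -> exists L U, canonical_rep r L U.
Proof.
case=> L0 [U0 [lu rE]].
pose D x := [set u | r u x].
have subD x y : (L0 x <= L0 y)%R -> D x \subset D y.
  by move=> xy; apply/subsetP => u; rewrite !inE => /rE ux; apply/rE; lra.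
have gap x y : #|D x| < #|D y| -> exists u, r u y /\ ~~ r u x.
  move=> xy; have /subsetPn[u] : ~~ (D y \subset D x).
    by apply: contraL xy => /subset_leq_card; rewrite -leqNgt.
  by rewrite !inE => ux uy; exists u.
have irr x : ~~ r x x by apply/negP => /rE; have := lu x; lra.
pose f x := #|D x|; pose g x := \max_(y | ~~ r x y) f y.
have fg x y : ~~ r x y -> f y <= g x by move=> xy; apply: leq_bigmax_cond.
have gE x : exists2 u, ~~ r x u & g x = f u.
  have x_gt0 : 0 < #|[pred y | ~~ r x y]| by apply/card_gt0P; exists x; apply: irr.
  by have [u] := eq_bigmax_cond f x_gt0; exists u.
have rfg x y : r x y <-> g x < f y.
  split; last by apply: contraLR => /fg; rewrite -leqNgt.
  move=> xy; have [u xu ->] := gE x; apply/proper_card/properP; split.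
    apply: subD; case: (Rlt_dec (U0 x) (L0 u)) => [/rE|]; first by rewrite (negbTE xu).
    by move/rE: xy; lra.
  by exists x; rewrite inE.
exists (fun x => Z.of_nat (f x)), (fun x => Z.of_nat (g x)); split.
- by move=> x; have := fg _ _ (irr x); lia.
- by move=> x y; rewrite rfg; lia.
- move=> x y xy; have [|u [/rfg uy ux]] := gap x y.
    by rewrite -/(f x) -/(f y); lia.
  by exists u; have := fg _ _ ux; lia.
- move=> x y xy; have [u yu yE] := gE y; exists u; lia.
Qed.

(** * Endpoint patterns excluded by the forbidden posets *)

Ltac embed canon s :=
  let rE := constr:(precE canon) in
  let xs := eval hnf in s in
  match xs with ?x :: _ => apply: (@contains_induced_nth _ _ _ _ x s) end;
  [by vm_compute | by vm_compute |];
  move=> [|[|[|[|[|[|?]]]]]] [|[|[|[|[|[|?]]]]]] // _ _;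
  match goal with |- _ = ?b =>
    let v := eval vm_compute in b in
    change b with v; cbn [nth];
    match v with
    | true => apply/rE
    | false => apply/negbTE/negP => /rE
    end
  end.

Definition contains (T : finType) (L U : T -> Z) (x b : T) : bool :=
  (L x <? L b)%Z && (U b <? U x)%Z.

Lemma containsP (T : finType) (L U : T -> Z) (x b : T) :
  reflect ((L x < L b)%Z /\ (U b < U x)%Z) (contains L U x b).
Proof. by apply: (iffP andP) => -[/Z.ltb_spec0 ? /Z.ltb_spec0 ?]. Qed.

Section ForbiddenConfigurations.

Variables (T : finType) (r : rel T) (L U : T -> Z).
Hypotheses (canon : canonical_rep r L U) (rP : avoids r).

Lemma avoids_four_plus_one a b c d x :
  (U a < L b)%Z -> (U b < L c)%Z -> (U c < L d)%Z ->
  (L x <= U a)%Z -> (L d <= U x)%Z -> False.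
Proof.
have lu := ends_le canon.
move: (lu a) (lu b) (lu c) (lu d) (lu x) => *; case: rP => + _; apply.
embed canon [:: a; b; c; d; x]; lia.
Qed.

Lemma avoids_D_star a b c d x y :
  (U a < L b)%Z -> (L b <= U y)%Z -> (U y < L c)%Z -> (L c <= U b)%Z ->
  (U b < L d)%Z -> (U c < L d)%Z -> (L x <= U a)%Z -> (L d <= U x)%Z -> False.
Proof.
have lu := ends_le canon.
move: (lu a) (lu b) (lu c) (lu d) (lu x) (lu y) => *.
have [ay|ya] := Z_lt_le_dec (U a) (L y).
  by apply: (@avoids_four_plus_one a y c d x).
case: rP => _ [+ _]; apply.
embed canon [:: a; b; c; d; x; y]; lia.
Qed.

(* Depending on how [y] meets [a] and [b], and [x] meets [d], the six elements
   contain 4+1, Z or Y*. *)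
Lemma avoids_Z_or_Y_star a b c d x y :
  (U a < L b)%Z -> (U b < L c)%Z -> (U c < L d)%Z ->
  (L x <= U a)%Z -> (L c <= U x)%Z -> (L y <= U c)%Z -> (L y <= U x)%Z ->
  (L d <= U y)%Z -> False.
Proof.
have lu := ends_le canon.
move: (lu a) (lu b) (lu c) (lu d) (lu x) (lu y) => *.
have [dx|xd] := Z_le_gt_dec (L d) (U x).
  by apply: (@avoids_four_plus_one a b c d x).
have [ay|ya] := Z_lt_le_dec (U a) (L y); last first.
  by apply: (@avoids_four_plus_one a b c d y).
case: rP => _ [_ [noZ [noY _]]].
have [bY|yb] := Z_lt_le_dec (U b) (L y).
  by apply: noY; embed canon [:: a; b; c; d; x; y]; lia.
by apply: noZ; embed canon [:: a; b; c; d; x; y]; lia.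
Qed.

End ForbiddenConfigurations.

Section TightConfigurations.

Variables (T : finType) (r : rel T) (L U : T -> Z).
Hypotheses (canon : canonical_rep r L U).
Hypotheses (rP : avoids r) (drP : avoids (dual_rel r)).

Let dual_canon := canonical_rep_dual canon.

(* [d] sits strictly inside [x], which pins both and makes [d] open, so nothing
   following [d] can start before [c]; the violations are 4+1, the dual of D*
   and Y**. *)
Lemma tight_right a d b y c x :
  (U a < L d)%Z -> (U d < L b)%Z -> (L b <= U y)%Z -> (U y < L c)%Z ->
  (L x <= U a)%Z -> (L c <= U x)%Z -> False.
Proof.
have lu := ends_le canon.
move: (lu a) (lu b) (lu c) (lu d) (lu x) (lu y) => *.
have [cb|bc] := Z_le_gt_dec (L c) (U b); last first.
  by apply: (avoids_four_plus_one canon rP (a:=a) (b:=d) (c:=b) (d:=c) (x:=x)); lia.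
have [ay|ya] := Z_lt_le_dec (U a) (L y).
  apply: (avoids_D_star dual_canon drP
    (a:=c) (b:=y) (c:=d) (d:=a) (x:=x) (y:=b)); try lia.
  have [//|dy] := Z_le_gt_dec (L y) (U d); first lia.
  by case: (avoids_four_plus_one canon rP (a:=a) (b:=d) (c:=y) (d:=c) (x:=x)); lia.
case: rP => _ [_ [_ [_ +]]]; apply.
by embed canon [:: a; b; c; d; x; y]; lia.
Qed.

End TightConfigurations.

(** * Strict containment of intervals *)

Section Containment.

Variables (T : finType) (r : rel T) (L U : T -> Z).
Hypotheses (canon : canonical_rep r L U).
Hypotheses (rP : avoids r) (drP : avoids (dual_rel r)).

Let dual_canon := canonical_rep_dual canon.

(** In a unit representation [x] would be closed, for containing [b], and open, for lying inside
    [y]. *)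
Lemma contains_trans_false x b y : contains L U x b -> contains L U y x -> False.
Proof.
move=> /containsP[xb bx] /containsP[yx xy].
have [a [xa ab]] := left_gap canon yx.
have [c [bc cx]] := right_gap canon bx.
have [c' [bc' cx']] := right_gap canon xy.
by apply: (tight_right canon rP drP (a:=a) (d:=b) (b:=c) (y:=x) (c:=c') (x:=y)); lia.
Qed.

(* In a unit representation these hypotheses force [x] to start exactly where
   [a] ends; any other [d] not preceding [x] must then end at or after [a]. *)
Lemma tight_min a b x d :
  (U a < L b)%Z -> contains L U x b -> (L x <= U a)%Z -> (L x <= U d)%Z ->
  (L a <= L d)%Z /\ (U a <= U d)%Z.
Proof.
move=> ab /containsP[xb bx] xa xd.
have [c [bc cx]] := right_gap canon bx.
have le_Ua : (U a <= U d)%Z.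
  have [//|/Z.gt_lt da] := Z_le_gt_dec (U a) (U d).
  have [e [de ea]] := right_gap canon da.
  by case: (tight_right dual_canon drP rP
    (a:=c) (d:=b) (b:=a) (y:=e) (c:=d) (x:=x)); lia.
split=> //; have [//|/Z.gt_lt da] := Z_le_gt_dec (L a) (L d).
have [u [du ua]] := left_gap canon da.
have := ends_le canon a => ?.
by case: (avoids_Z_or_Y_star dual_canon drP
  (a:=c) (b:=b) (c:=a) (d:=u) (x:=x) (y:=d)); lia.
Qed.

(** If [y] started later than [x], some element would end in between and contradict [tight_min]; if
    it ended later, it would form the pattern of [tight_right]. *)
Lemma tight_max a b x y :
  (U a < L b)%Z -> contains L U x b -> (L x <= U a)%Z -> (L y <= U a)%Z ->
  (L y <= L x)%Z /\ (U y <= U x)%Z.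
Proof.
move=> ab xb xa ya; have /containsP[xb1 bx] := xb.
have [c [bc cx]] := right_gap canon bx; split.
  have [//|/Z.gt_lt xy] := Z_le_gt_dec (L y) (L x).
  have [u [xu uy]] := left_gap canon xy.
  by have := tight_min ab xb xa xu; lia.
have [//|/Z.gt_lt xy] := Z_le_gt_dec (U y) (U x).
have [c' [xc cy]] := right_gap canon xy.
by case: (tight_right canon rP drP (a:=a) (d:=b) (b:=c) (y:=x) (c:=c') (x:=y)); lia.
Qed.

(** In a unit representation [b] shares the place of [x], and against the open [c] it is irrelevant
    whether the other element is open or closed. *)
Lemma contains_prec x b y c : contains L U x b -> contains L U y c ->
  (U b < L c)%Z -> (U x < L c)%Z.
Proof.
move=> /containsP[xb bx] /containsP[yc cy] bc.
have [cx|//] := Z_le_gt_dec (L c) (U x); last lia.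
have [a [xa ab]] := left_gap canon xb.
have [d [cd dy]] := right_gap canon cy.
have := ends_le canon c => ?.
by case: (avoids_Z_or_Y_star canon rP (a:=a) (b:=b) (c:=c) (d:=d) (x:=x) (y:=y)); lia.
Qed.

End Containment.

(** * Solving distance constraints over the reals *)

Lemma finite_argmax (T : finType) (P : pred T) (f : T -> R) (x0 : T) :
  P x0 -> exists2 x, P x & forall y, P y -> (f y <= f x)%R.
Proof.
move=> Px0.
suff [x Px xP] : exists2 x, P x & forall y, y \in enum P -> (f y <= f x)%R.
  by exists x => // y Py; apply: xP; rewrite mem_enum.
have: all P (enum P) by apply/allP=> y; rewrite mem_enum.
elim: (enum P) => [|a s IHs] /=; first by exists x0.
case/andP=> Pa /IHs[x Px xs]; case: (Rle_dec (f a) (f x)) => ax.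
  by exists x => // y; rewrite inE => /predU1P[->|/xs].
exists a => // y; rewrite inE => /predU1P[->|/xs]; lra.
Qed.

Lemma finite_between (S T : finType) (P : pred S) (Q : pred T)
    (f : S -> R) (g : T -> R) :
  (forall x y, P x -> Q y -> (f x < g y)%R) ->
  exists v, (forall x, P x -> (f x < v)%R) /\ (forall y, Q y -> (v < g y)%R).
Proof.
move=> fg; case: (pickP P) => [x0 Px0|P0]; last first.
  case: (pickP Q) => [y0 Qy0|Q0]; last first.
    by exists 0%R; split=> [x|y]; rewrite ?P0 ?Q0.
  have [y Qy yP] := finite_argmax (fun y => - g y)%R Qy0.
  exists (g y - 1)%R; split=> [x|z /yP]; [by rewrite P0 | lra].
have [x Px xP] := finite_argmax f Px0.
case: (pickP Q) => [y0 Qy0|Q0]; last first.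
  exists (f x + 1)%R; split=> [z /xP|z]; [lra | by rewrite Q0].
have [y Qy yP] := finite_argmax (fun y => - g y)%R Qy0.
have := fg _ _ Px Qy.
exists ((f x + g y) / 2)%R; split=> [z /xP|z /yP]; lra.
Qed.

(* Real values are assigned greedily in increasing rank: a new top element [z] is
   placed exactly one unit after some [t] when [s' t z] holds but [s t z] fails,
   and otherwise strictly between finitely many lower and upper bounds. *)
Lemma threshold_potential (T : finType) (rk : T -> nat) (s s' : rel T) :
  (forall x y, s' x y -> rk x < rk y) ->
  (forall x y, s x y -> s' x y) ->
  (forall x' x y y', rk x' <= rk x -> s x y -> rk y <= rk y' -> s x' y') ->
  (forall x' x y y', rk x' = rk x -> s' x y -> rk y = rk y' -> s' x' y') ->
  (forall x' x y y', rk x' <= rk x -> s' x y -> rk y <= rk y' ->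
     s x' y' \/ (rk x' = rk x /\ rk y = rk y')) ->
  exists p : T -> R, forall x y,
    (s x y <-> (p x + 1 < p y)%R) /\ (s' x y <-> (p x + 1 <= p y)%R).
Proof.
move=> rk_s' s_s' s_mono s'_inv s'_mono.
(* The induction also carries that [p] is strictly increasing in the rank, which lets bounds pass
   between elements of different rank. *)
suff /(_ (\max_x rk x).+1)[p pP] : forall n, exists p : T -> R,
    forall x y, rk x < n -> rk y < n ->
    [/\ rk x < rk y -> (p x < p y)%R, rk x = rk y -> p x = p y,
        s x y <-> (p x + 1 < p y)%R & s' x y <-> (p x + 1 <= p y)%R].
  by exists p => x y; have [| | _ _ ? ?] := pP x y; rewrite ?ltnS ?leq_bigmax.
elim=> [|n [p pP]]; first by exists (fun=> 0%R).
have [z /eqP zn|none] := pickP (fun z => rk z == n); last first.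
  have lt_n x : rk x < n.+1 -> rk x < n by rewrite ltnS leq_eqVlt none.
  by exists p => x y /lt_n xn /lt_n; apply: pP.
have [v vP] : exists v, forall y, rk y < n ->
    [/\ (p y < v)%R, s y z <-> (p y + 1 < v)%R & s' y z <-> (p y + 1 <= v)%R].
  have [t /andP[tz Ntz]|eq_s] := pickP (fun t => s' t z && ~~ s t z).
    exists (p t + 1)%R => y yn; have tn : rk t < n by rewrite -zn; apply: rk_s'.
    have [lt_yt eq_yt _ _] := pP _ _ yn tn.
    have [lt_ty _ _ s'_ty] := pP _ _ tn yn; split.
    + apply: Rnot_le_lt => /s'_ty ty.
      have yz : rk y <= rk z by rewrite zn ltnW.
      case: (s'_mono t t y z (leqnn _) ty yz) => [stz|[_ E]].
        by rewrite stz in Ntz.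
      by rewrite E zn ltnn in yn.
    + split=> [yz|yt].
        have [/lt_yt|ty] := ltnP (rk y) (rk t); first lra.
        by rewrite (s_mono t y z z) in Ntz.
      have {}lt_rk : rk y < rk t.
        have [//|/lt_ty|/eq_yt] := ltngtP (rk y) (rk t); lra.
      case: (s'_mono y t z z (ltnW lt_rk) tz (leqnn _)) => // -[E _].
      by rewrite E ltnn in lt_rk.
    + split=> [yz|yt].
        have [/lt_yt|ty|/eq_yt ->] := ltngtP (rk y) (rk t); [lra| |lra].
        case: (s'_mono t y z z (ltnW ty) yz (leqnn _)) => [stz|[E _]].
          by rewrite stz in Ntz.
        by rewrite E ltnn in ty.
      have [lt_rk|/lt_ty|E] := ltngtP (rk y) (rk t); [|lra|]; last exact: s'_inv tz _.
      case: (s'_mono y t z z (ltnW lt_rk) tz (leqnn _)) => [/s_s' //|[E _]].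
      by rewrite E ltnn in lt_rk.
  have {}eq_s y : s' y z = s y z.
    by apply/idP/idP=> [yz|/s_s' //]; have := eq_s y; rewrite /= yz => /negbFE.
  (* The boolean selects the lower bound: [p y] for every earlier [y], and [p y + 1] when [s y z]
     holds. *)
  have [|v [lo hi]] := @finite_between (T * bool)%type T
    (fun yb => (rk yb.1 < n) && (yb.2 ==> s yb.1 z))
    (fun y => (rk y < n) && ~~ s' y z)
    (fun yb => p yb.1 + (if yb.2 then 1 else 0))%R (fun y => p y + 1)%R.
    case=> y b y1 /= /andP[yn yz] /andP[y1n y1z].
    have [_ _ _ s'P] := pP _ _ y1n yn; case: b yz => /= [yz|_].
      have [lt_yy1 _ _ _] := pP _ _ yn y1n.
      have [/lt_yy1|le] := ltnP (rk y) (rk y1); first lra.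
      by rewrite eq_s (s_mono y1 y z z) in y1z.
    apply: Rnot_le_lt => y1y; have /s'P {}y1y : (p y1 + 1 <= p y)%R by lra.
    have yz : rk y <= rk z by rewrite zn ltnW.
    case: (s'_mono y1 y1 y z (leqnn _) y1y yz) => [sy|[_ E]].
      by rewrite eq_s sy in y1z.
    by rewrite E zn ltnn in yn.
  exists v => y yn; have y0 := lo (y, false); rewrite /= yn andbT in y0.
  have {}y0 := y0 isT; rewrite eq_s.
  have y1 := lo (y, true); have y2 := hi y; rewrite /= yn ?eq_s /= in y1 y2.
  case: (s y z) y1 y2 => [/(_ isT) y1 _|_ /(_ isT) y2];
    split; try split=> //; lra.
exists (fun x => if rk x < n then p x else v) => x y.
rewrite !ltnS => xn yn.
have rk_z w : rk w <= n -> (rk w < n) = false -> rk w = rk z by rewrite zn; lia.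
have Ns_z w : rk w = rk z -> forall u, rk u <= n -> s' w u = false.
  by move=> wz u un; apply/negP=> /rk_s'; rewrite wz zn ltnNge un.
have Ns w u : s' w u = false -> s w u = false.
  by move=> E; apply/negP=> /s_s'; rewrite E.
case: ifP => [x_lt|/(rk_z _ xn) xz]; case: ifP => [y_lt|/(rk_z _ yn) yz].
- exact: pP.
- have [pv sv s'v] := vP _ x_lt.
  have -> : s x y = s x z by apply/idP/idP=> xs; apply: s_mono xs _; rewrite ?yz.
  have -> : s' x y = s' x z by apply/idP/idP=> xs; apply: s'_inv xs _; rewrite ?yz.
  by split=> // E; rewrite E yz zn ltnn in x_lt.
- have [pv _ _] := vP _ y_lt.
  have s'F := Ns_z _ xz _ yn; rewrite s'F (Ns _ _ s'F).
  split; try (split=> //; lra); first by rewrite xz zn; lia.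
  by rewrite xz zn => E; rewrite E ltnn in y_lt.
- have s'F := Ns_z _ xz _ yn; rewrite s'F (Ns _ _ s'F) xz yz ltnn.
  by split=> //; split=> //; lra.
Qed.

(** * Unit representations through left endpoints *)

Definition unit_rep (T : finType) (r : rel T) (l : T -> R) (op : T -> bool)
    (len : R) : Prop :=
  (0 <= len)%R /\ (forall x, op x -> (0 < len)%R) /\
  (forall x y, r x y <-> if op x || op y then (l x + len <= l y)%R
                         else (l x + len < l y)%R).

Lemma oc_precE (lx ly len : R) (ox oy : bool) :
  oc_nonempty lx (lx + len) ox -> oc_nonempty ly (ly + len) oy ->
  (forall p q, oc_mem lx (lx + len) ox p -> oc_mem ly (ly + len) oy q ->
     (p < q)%R) <->
  (if ox || oy then (lx + len <= ly)%R else (lx + len < ly)%R).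
Proof.
move=> nx ny; split; last first.
  case: ox nx; case: oy ny; rewrite /oc_nonempty /oc_mem /= => ? ? ? ? ?; lra.
move=> xy; case: (Rle_dec (lx + len) ly) => [le|/Rnot_le_lt gt].
  case: (Req_dec (lx + len) ly) => [E|ne]; last by case: (_ || _); lra.
  case: ox nx xy; case: oy ny; rewrite /oc_nonempty /oc_mem /= => ? ? xy; try lra.
  by have := xy (lx + len)%R ly; lra.
(* Moving in by half of the smaller of length and overlap keeps both test points inside their
   intervals and in the wrong order. *)
pose m := (Rmin len (lx + len - ly) / 2)%R.
have [m1 m2] : (m <= len / 2 /\ m <= (lx + len - ly) / 2)%R.
  have := Rmin_l len (lx + len - ly); have := Rmin_r len (lx + len - ly).
  by rewrite /m; lra.
have len_ge0 : (0 <= len)%R by case: ox nx {xy}; rewrite /oc_nonempty; lra.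
have m_ge0 : (0 <= m)%R by rewrite /m; apply/Rmult_le_pos; [apply: Rmin_glb|]; lra.
have m_gt0 : (0 < len -> 0 < m)%R.
  by move=> ?; rewrite /m; apply/Rmult_lt_0_compat; [apply: Rmin_glb_lt|]; lra.
have /Rlt_not_le[] : (lx + len - m < ly + m)%R; last lra.
apply: xy; rewrite /oc_mem.
  by case: ox nx; rewrite /oc_nonempty => nx; have := m_gt0; lra.
by case: oy ny; rewrite /oc_nonempty => ny; have := m_gt0; lra.
Qed.

Lemma unit_OC_interval_orderE (T : finType) (r : rel T) :
  unit_OC_interval_order r <-> exists l op len, unit_rep r l op len.
Proof.
split=> [[l [u [op [ne [eqlen rE]]]]]|[l [op [len [len_ge0 [op_len rE]]]]]].
  case: (pickP (@predT T)) => [x0 _|none]; last first.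
    by exists (fun=> 0%R), op, 0%R; split=> [|]; [lra | split=> x; have := none x].
  have uE x : u x = (l x + (u x0 - l x0))%R by have := eqlen x x0; lra.
  exists l, op, (u x0 - l x0)%R; split.
    by have := ne x0; rewrite /oc_nonempty; case: (op x0); lra.
  split=> [x opx|x y]; first by have := ne x; rewrite /oc_nonempty opx uE; lra.
  have := ne x; have := ne y; rewrite rE (uE x) (uE y) => *; exact: oc_precE.
have ne x : oc_nonempty (l x) (l x + len) (op x).
  by rewrite /oc_nonempty; case: (op x) (op_len x) => [/(_ isT)|_]; lra.
exists l, (fun x => l x + len)%R, op; split=> //; split=> [x y|x y]; first lra.
by rewrite rE; split=> /oc_precE; apply.
Qed.

Lemma unit_rep_dual (T : finType) (r : rel T) l op len :
  unit_rep r l op len -> unit_rep (dual_rel r) (fun x => - l x)%R op len.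
Proof.
case=> len_ge0 [op_len rE]; split=> //; split=> // x y.
by rewrite /dual_rel rE orbC; case: ifP => _; split; lra.
Qed.

(** * Necessity: infeasible systems from the forbidden posets *)

Ltac contradict_ends op opF :=
  lazy zeta; case: opF => [opF|len_gt0];
  [rewrite !opF /=; lra
  |repeat match goal with
   | |- context [op (?f ?i)] => generalize (op (f i)); case
   end; cbn [orb]; lra].

Lemma unit_rep_avoids (T : finType) (r : rel T) l op len :
  unit_rep r l op len -> avoids r.
Proof.
case=> len_ge0 [op_len rE].
have opF : (forall x, op x = false) \/ (0 < len)%R.
  case: (Rle_lt_or_eq_dec _ _ len_ge0) => [|len0]; first by right.
  by left=> x; apply/negP => /op_len; lra.
have prec n E (f : 'I_n -> T) : (forall i j, r (f i) (f j) = tc_rel E i j) ->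
    edges_below n E ->
    forall i j (lti : i < n) (ltj : j < n), reach n E i j ->
    let x := f (Ordinal lti) in let y := f (Ordinal ltj) in
    if op x || op y then (l x + len <= l y)%R else (l x + len < l y)%R.
  move=> rf En i j lti ltj ij x y; have := rf (Ordinal lti) (Ordinal ltj).
  by rewrite tc_relE //= ij => /rE.
have nprec n E (f : 'I_n -> T) : (forall i j, r (f i) (f j) = tc_rel E i j) ->
    edges_below n E ->
    forall i j (lti : i < n) (ltj : j < n), ~~ reach n E i j ->
    let x := f (Ordinal lti) in let y := f (Ordinal ltj) in
    if op x || op y then (l y < l x + len)%R else (l y <= l x + len)%R.
  move=> rf En i j lti ltj ij x y; have := rf (Ordinal lti) (Ordinal ltj).
  rewrite tc_relE //= (negbTE ij) -/x -/y => rxy.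
  have {rxy} : ~ r x y by rewrite rxy.
  by rewrite rE; case: (_ || _) => [/Rnot_le_lt|/Rnot_lt_le].
split; [|split; [|split; [|split]]] => -[f [_ rf]];
  have {}prec := prec _ _ f rf isT; have {}nprec := nprec _ _ f rf isT.
- move: (prec 0 1 isT isT isT) (prec 1 2 isT isT isT) (prec 2 3 isT isT isT)
    (nprec 0 4 isT isT isT) (nprec 4 3 isT isT isT).
  contradict_ends op opF.
(* Inside [x], both [b] and [c] are open at the same place, so [y] would precede both or neither. *)
- move: (prec 0 1 isT isT isT) (prec 1 3 isT isT isT) (prec 0 2 isT isT isT)
    (prec 2 3 isT isT isT) (prec 5 2 isT isT isT) (nprec 0 4 isT isT isT)
    (nprec 4 3 isT isT isT) (nprec 2 1 isT isT isT) (nprec 5 1 isT isT isT)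
   (nprec 0 5 isT isT isT).
  contradict_ends op opF.
(* The chain [a], [b], [c] meeting [x] closes [c], while [b], [c], [d] meeting [y] opens it. *)
- move: (prec 0 1 isT isT isT) (prec 1 2 isT isT isT) (prec 2 3 isT isT isT)
    (prec 4 3 isT isT isT) (prec 0 5 isT isT isT) (nprec 0 4 isT isT isT)
    (nprec 4 2 isT isT isT) (nprec 1 5 isT isT isT) (nprec 5 3 isT isT isT).
  contradict_ends op opF.
(* Here [p] and [b] are forced to be closed at the same place, yet only [p] precedes [c]. *)
- move: (prec 0 1 isT isT isT) (prec 1 2 isT isT isT) (prec 2 3 isT isT isT)
    (prec 4 3 isT isT isT) (prec 1 5 isT isT isT) (nprec 0 4 isT isT isT)
    (nprec 4 2 isT isT isT) (nprec 2 5 isT isT isT) (nprec 5 3 isT isT isT)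
    (nprec 4 5 isT isT isT).
  contradict_ends op opF.
(* Here [b] and [c] are forced to be closed at the same place, yet [y] precedes only [c]. *)
- move: (prec 0 3 isT isT isT) (prec 3 1 isT isT isT) (prec 3 2 isT isT isT)
    (prec 5 2 isT isT isT) (nprec 0 4 isT isT isT) (nprec 4 2 isT isT isT)
    (nprec 5 1 isT isT isT) (nprec 1 2 isT isT isT).
  contradict_ends op opF.
Qed.

(** * Sufficiency: construction of a unit representation *)

Section UnitRepresentation.

Variables (T : finType) (r : rel T) (L U : T -> Z).
Hypotheses (canon : canonical_rep r L U).
Hypotheses (rP : avoids r) (drP : avoids (dual_rel r)).

Let dual_canon := canonical_rep_dual canon.

Lemma contains_dual x b :
  contains L U x b -> contains (fun x => - U x)%Z (fun x => - L x)%Z x b.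
Proof. by move=> /containsP[? ?]; apply/containsP; split; lia. Qed.

Definition inner (b : T) : bool := [exists x, contains L U x b].

(* Elements strictly inside another one become open and share its position. *)
Definition container (b : T) : T := odflt b [pick x | contains L U x b].

Lemma container_inner b : inner b -> contains L U (container b) b.
Proof.
by move/existsP=> [x xb]; rewrite /container; case: pickP => [//|/(_ x)]; rewrite xb.
Qed.

Lemma container_outer b : ~~ inner b -> container b = b.
Proof.
move=> Nb; rewrite /container; case: pickP => [x xb|//].
by case/existsP: Nb; exists x.
Qed.

Lemma outer_container b : ~~ inner (container b).
Proof.
have [ib|Nb] := boolP (inner b); last by rewrite container_outer.
apply/existsP => -[y yx].
exact: contains_trans_false canon rP drP _ _ _ (container_inner ib) yx.
Qed.

Let CL x := L (container x).
Let CU x := U (container x).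

Lemma container_ends x :
  (CL x <= L x)%Z /\ (U x <= CU x)%Z /\
  (inner x -> CL x < L x /\ U x < CU x)%Z /\
  (~~ inner x -> CL x = L x /\ CU x = U x).
Proof.
rewrite /CL /CU; have [ix|Nx] := boolP (inner x).
  by have /containsP := container_inner ix; do !split=> //; lia.
by rewrite container_outer //; do !split=> //; lia.
Qed.

Definition rank (x : T) : nat := #|[set y | (CL y + CU y <? CL x + CU x)%Z]|.

(** No container strictly contains another, so comparing the sums of their ends compares both ends
    at once. *)
Lemma rank_leE x y : rank x <= rank y <-> (CL x <= CL y)%Z /\ (CU x <= CU y)%Z.
Proof.
have mono u v : (CL u + CU u <= CL v + CU v)%Z -> rank u <= rank v.
  move=> uv; apply/subset_leq_card/subsetP => w; rewrite !inE.
  by move=> /Z.ltb_spec0 ?; apply/Z.ltb_spec0; lia.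
split; last by move=> ?; apply: mono; lia.
move=> xy; have sum_le : (CL x + CU x <= CL y + CU y)%Z.
  have [//|/Z.gt_lt yx] := Z_le_gt_dec (CL x + CU x) (CL y + CU y).
  suff : rank y < rank x by rewrite ltnNge xy.
  apply/proper_card/properP; split.
    by apply/subsetP => w; rewrite !inE => /Z.ltb_spec0 ?; apply/Z.ltb_spec0; lia.
  by exists y; rewrite inE; [apply/Z.ltb_spec0; lia | rewrite Z.ltb_irrefl].
have not_contains u v : ~ (CL u < CL v /\ CU v < CU u)%Z.
  move=> uv; case/existsP: (outer_container v).
  by exists (container u); apply/containsP.
by have := not_contains x y; have := not_contains y x; lia.
Qed.

Lemma rank_eqE x y : rank x = rank y <-> CL x = CL y /\ CU x = CU y.
Proof.
split=> [E|[EL EU]].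
  by have := rank_leE x y; have := rank_leE y x; rewrite E leqnn; lia.
by apply/eqP; rewrite eqn_leq; apply/andP; split; apply/rank_leE; lia.
Qed.

(** If both are inner, [contains_prec] replaces [x] by its container; an outer element is its own
    container. *)
Lemma tight_prec x y : (U x < L y)%Z -> (CL y <= CU x)%Z ->
  (inner y /\ (CU x < L y)%Z) \/ (inner x /\ (U x < CL y)%Z).
Proof.
move=> xy tight; have [_ [_ [ix Nx]]] := container_ends x.
have [_ [_ [iy Ny]]] := container_ends y.
have [/[dup] yi /iy y_in|/Ny y_out] := boolP (inner y); last first.
  by have [xi|/Nx x_out] := boolP (inner x); [right; split=> //; lia | lia].
left; split=> //; have [xi|/Nx] := boolP (inner x); last lia.
exact: contains_prec canon rP _ _ _ _ (container_inner xi) (container_inner yi) xy.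
Qed.

(** Such places are exactly one unit apart. The case of inner [x] is the dual of that of inner [y],
    with [tight_min] and [tight_max] exchanged. *)
Lemma tight_extremal x y d : (U x < L y)%Z -> (CL y <= CU x)%Z ->
  ((CL y <= U d)%Z -> (CL x <= L d)%Z /\ (CU x <= U d)%Z) /\
  ((L d <= CU x)%Z -> (L d <= CL y)%Z /\ (U d <= CU y)%Z).
Proof.
move=> xy tight; have [[yi xLy]|[xi Uxy]] := tight_prec xy tight.
  have cy := container_inner yi; split.
    exact: tight_min canon rP drP _ _ _ _ xLy cy tight.
  exact: tight_max canon rP drP _ _ _ _ xLy cy tight.
have cx := contains_dual (container_inner xi).
have Uxy' : (- L (container y) < - U x)%Z by rewrite -/(CL y); lia.
have tight' : (- U (container x) <= - L (container y))%Z.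
  by rewrite -/(CL y) -/(CU x); lia.
have dmin := tight_min dual_canon drP rP Uxy' cx tight'.
have dmax := tight_max dual_canon drP rP Uxy' cx tight'.
by move: (dmin d) (dmax d); rewrite -/(CL x) -/(CL y) -/(CU x) -/(CU y); lia.
Qed.

Lemma avoids_unit_rep : exists p, unit_rep r p inner 1.
Proof.
(* [s] stands for distance more than one between places, [s'] for distance at least one. *)
pose s x y := (CU x <? CL y)%Z.
pose s' x y := [exists x0, exists y0,
  [&& rank x0 == rank x, rank y0 == rank y & (U x0 <? L y0)%Z]].
have sP x y : reflect (CU x < CL y)%Z (s x y) by apply: Z.ltb_spec0.
have s'P x y : s' x y <-> exists x0 y0, (CL x0 = CL x /\ CU x0 = CU x) /\
    (CL y0 = CL y /\ CU y0 = CU y) /\ (U x0 < L y0)%Z.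
  split=> [/existsP[x0 /existsP[y0 /and3P[/eqP/rank_eqE ? /eqP/rank_eqE ?]]]|].
    by move/Z.ltb_spec0; exists x0, y0.
  move=> [x0 [y0 [/rank_eqE/eqP xE [/rank_eqE/eqP yE /Z.ltb_spec0 xy]]]].
  by apply/existsP; exists x0; apply/existsP; exists y0; apply/and3P.
have CLU x : (CL x <= CU x)%Z by apply: ends_le canon _.
have CE x : CL (container x) = CL x /\ CU (container x) = CU x.
  by rewrite /CL /CU container_outer ?outer_container.
have [|||||p pP] := @threshold_potential T rank s s'.
(* Otherwise both would share one place, and an inner element would lie outside its own
   container. *)
- move=> x y /s'P[x0 [y0 [xE [yE xy]]]]; rewrite ltnNge; apply/negP => /rank_leE yx.
  have tight : (CL y0 <= CU x0)%Z by have := CLU y0; lia.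
  have [_ /(_ _)] := tight_extremal (container x0) xy tight.
  rewrite -/(CL x0) -/(CU x0) => /(_ (CLU x0)) x_y.
  have [_ [_ [ix _]]] := container_ends x0; have [_ [_ [iy _]]] := container_ends y0.
  have := ends_le canon x0; have := ends_le canon y0.
  by case: (tight_prec xy tight) => -[]; [move/iy | move/ix]; lia.
- move=> x y /sP xy; apply/s'P; exists (container x), (container y).
  by have := CE x; have := CE y.
- move=> x' x y y' /rank_leE xx' /sP xy /rank_leE yy'; apply/sP; lia.
- move=> x' x y y' /rank_eqE xx' /s'P[x0 [y0 xy]] /rank_eqE yy'; apply/s'P.
  by exists x0, y0; lia.
- move=> x' x y y' xx' /s'P[x0 [y0 [xE [yE xy]]]] yy'.
  have [/sP|tight'] := Z_lt_le_dec (CU x') (CL y'); [by left | right].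
  have /rank_leE xx1 := xx'; have /rank_leE yy1 := yy'.
  have tight : (CL y0 <= CU x0)%Z by lia.
  have [xmin _] := tight_extremal (container x') xy tight.
  have [_ ymax] := tight_extremal (container y') xy tight.
  move: xmin ymax; rewrite -/(CL x') -/(CU x') -/(CL y') -/(CU y') => xmin ymax.
  by rewrite !rank_eqE; lia.
exists p; split; first lra; split; first by move=> *; lra.
move=> x y; rewrite (precE canon); have [sE s'E] := pP x y.
suff -> : (U x < L y)%Z <-> (if inner x || inner y then s' x y else s x y).
  by case: ifP.
have [xl [xu [ix Nx]]] := container_ends x.
have [yl [yu [iy Ny]]] := container_ends y.
case: ifP => [xyi|/norP[/Nx xo /Ny yo]]; last first.
  by split=> [|/sP]; [move=> ?; apply/sP|]; lia.
split=> [xy|/s'P[x0 [y0 [xE [yE xy]]]]].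
  by apply/s'P; exists x, y.
have [|tight] := Z_lt_le_dec (CU x) (CL y); first lia.
have [//|yx] := Z_lt_le_dec (U x) (L y).
(* Were [x] not before [y], extremality would make [x] end with its container and [y] start with its
   own, so neither would be inner. *)
have tight0 : (CL y0 <= CU x0)%Z by lia.
have [_ ymax] := tight_extremal y xy tight0.
have [xmin _] := tight_extremal x xy tight0.
have [/iy|/[dup] Niy /Ny] := boolP (inner y); first lia.
by move: xyi; rewrite (negbTE Niy) orbF => /ix; lia.
Qed.

End UnitRepresentation.

Theorem theorem17 (T : finType) (r : rel T) :
  strict_poset r -> interval_order r ->
  (unit_OC_interval_order r <->
   (~ contains_induced four_plus_one r /\
    ~ contains_induced D_star r /\
    ~ contains_induced Z_poset r /\
    ~ contains_induced Y_star r /\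
    ~ contains_induced Y_star_star r /\
    ~ contains_induced (dual_rel four_plus_one) r /\
    ~ contains_induced (dual_rel D_star) r /\
    ~ contains_induced (dual_rel Z_poset) r /\
    ~ contains_induced (dual_rel Y_star) r /\
    ~ contains_induced (dual_rel Y_star_star) r)).
Proof.
move=> _ /interval_order_canonical[L [U canon]].
have dualE n (q : rel 'I_n) :
    contains_induced (dual_rel q) r <-> contains_induced q (dual_rel r).
  by split=> -[f [fI fE]]; exists f; split=> // i j; apply: fE.
rewrite unit_OC_interval_orderE.
rewrite (dualE _ four_plus_one) (dualE _ D_star) (dualE _ Z_poset).
rewrite (dualE _ Y_star) (dualE _ Y_star_star).
split=> [[l [op [len rep]]]|[? [? [? [? [? drP]]]]]].
  have [? [? [? [? ?]]]] := unit_rep_avoids rep.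
  by have [? [? [? [? ?]]]] := unit_rep_avoids (unit_rep_dual rep).
have rP : avoids r by [].
by have [p pP] := avoids_unit_rep canon rP drP; exists p, (inner L U), 1%R.
Qed.
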